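(* For every reduced knot projection $P$ (with at least one crossing), $$\mathrm{IR}(P) \leq d(P) \leq c(P)-\mathrm{IR}(P)-1,$$ where $c(P)$ denotes the number of crossings of $P$, $d(P)$ the warping degree of $P$ and $\mathrm{IR}(P)$ the maximal independent region number of $P$.
   Context: A knot projection is the image on the sphere $S^2$ of a generic immersion of a circle whose only singularities are finitely many transversal double points, called crossings. A knot diagram is a knot projection with over/under information at every crossing. All knot projections and knot diagrams are assumed to have at least one crossing. A crossing is reducible if some single region (see below) meets it in two opposite corners; a projection or diagram is reduced if it has no reducible crossing. Regions: The regions of a projection (or diagram) are the connected components of its complement in $S^2$. A region and a crossing are incident if the crossing lies on the boundary of the region. Regions are independent if they share no crossings, i.e. no crossing is incident to two distinct ones among them. For a knot projection $P$ and a crossing $c$ of $P$ (a base crossing), an independent region set for $P^c$ is a set of independent regions of $P$ none of which is incident to $c$. $\mathrm{IR}(P^c)$ is the maximal cardinality of an independent region set for $P^c$ (the empty set is allowed), and $\mathrm{IR}(P)$, the maximal independent region number of $P$, is the maximum of $\mathrm{IR}(P^c)$ over all crossings $c$ of $P$. Warping degree: For an oriented knot diagram $D$ with a base point $b$ on $D$ that is not a crossing, a warping crossing point of $D_b$ is a crossing which is met first as an under-crossing when traveling along $D$ from $b$ following the orientation; $d(D_b)$ is the number of warping crossing points of $D_b$. The warping degree $d(D)$ of $D$ is the minimum of $d(D_b)$ over all base points $b$. A knot diagram is alternating if over-crossings and under-crossings are met alternately when traveling along it. The warping degree $d(P)$ of an (unoriented) knot projection $P$ is the minimum of $d(D)$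 over all oriented alternating diagrams $D$ obtained from $P$ by giving an orientation and crossing information. *)

(* Defs.v *)
From mathcomp Require Import all_boot all_fingroup.

Set Implicit Arguments.
Unset Strict Implicit.
Unset Printing Implicit Defensive.

Local Open Scope group_scope.

(* A knot projection, i.e. the image of a generic immersion of a circle in the
   oriented sphere with at least one crossing, is a 4-valent plane graph and is
   represented, up to homeomorphism of the sphere, by its combinatorial map.
   A dart is a half-edge, thought of as leaving its crossing; [flip] exchanges
   the two halves of an edge and [turn] maps a dart to the next one
   counterclockwise around its crossing.  In MathComp, [(s * t) x = t (s x)]. *)
Section PlaneMap.

Variables (dart : finType) (flip turn : {perm dart}).

(* Leave along a dart and go straight through the next crossing (the curve
   crosses itself transversally, so straight ahead is two turns away). *)
Definition map_ahead : {perm dart} := flip * turn * turn.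

(* Leave along a dart and take the next corner of the region on its left. *)
Definition map_face : {perm dart} := flip * turn^-1.

End PlaneMap.

(* [one_circle]: from any dart, the curve reaches each edge, in one direction
   or the other; it also makes the graph connected, so [euler] (V + F = E + 2)
   states that the surface carrying the map is the sphere.  [euler] forces
   the map to be nonempty, i.e. to have at least one crossing. *)
Record knot_projection := KnotProjection {
  dart : finType;
  flip : {perm dart};
  turn : {perm dart};
  flipK : involutive flip;
  flip_neq : forall x, flip x != x;
  four_valent : forall x, #|porbit turn x| = 4;
  one_circle : forall x y,
    (y \in porbit (map_ahead flip turn) x) ||
    (flip y \in porbit (map_ahead flip turn) x);
  euler : #|porbits turn| + #|porbits (map_face flip turn)|
          = #|porbits flip| + 2
}.

Section KnotProjection.

Variable P : knot_projection.

Local Notation D := (dart P).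

Definition ahead : {perm D} := map_ahead (flip P) (turn P).

Definition crossings : {set {set D}} := porbits (turn P).

Definition ncrossings : nat := #|crossings|.

(* A region is the set of its corners: a dart [x] stands for the corner
   between [x] and [turn P x]. *)
Definition regions : {set {set D}} := porbits (map_face (flip P) (turn P)).

Definition incident (R C : {set D}) : bool := R :&: C != set0.

(* The corners [x] and [turn P (turn P x)] of a crossing are opposite. *)
Definition reducible_crossing (C : {set D}) : bool :=
  [exists R in regions, exists x in C,
    (x \in R) && (turn P (turn P x) \in R)].

Definition reduced : bool :=
  [forall C in crossings, ~~ reducible_crossing C].

Definition independent (S : {set {set D}}) : bool :=
  [forall R1 in S, forall R2 in S, (R1 != R2) ==>
    [forall C in crossings, ~~ (incident R1 C && incident R2 C)]].

Definition independent_region_set (C : {set D}) (S : {set {set D}}) : bool :=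
  [&& S \subset regions, independent S & [forall R in S, ~~ incident R C]].

Definition IR_at (C : {set D}) : nat :=
  \max_(S | independent_region_set C S) #|S|.

Definition IR : nat := \max_(C in crossings) IR_at C.

(* Crossing information is the set of the darts that lie on the over-strand
   of their crossing. *)
Definition crossing_info (ov : {set D}) : bool :=
  [forall x, (turn P x \in ov) == (x \notin ov)].

(* An orientation is the set of the darts along which the oriented knot leaves
   a crossing.  A dart [y] of an orientation [O] also names the passage of the
   curve through a crossing that ends by leaving along [y]. *)
Definition orientations : {set {set D}} := porbits ahead.

Definition alternating (ov O : {set D}) : bool :=
  [forall y in O, (ahead y \in ov) != (y \in ov)].

(* A base point is not a crossing, so it lies on an edge, which is named by
   the dart [b] of the orientation that runs along it.  The itinerary lists
   the passages in the order in which they are met from there; the last one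
   is the passage [b] itself. *)
Definition itinerary (b : D) : seq D :=
  traject ahead (ahead b) #|porbit ahead b|.

Definition first_passage (b : D) (C : {set D}) : D :=
  head b [seq y <- itinerary b | y \in C].

Definition warping_crossing (ov : {set D}) (b : D) (C : {set D}) : bool :=
  first_passage b C \notin ov.

Definition warping_degree_at (ov : {set D}) (b : D) : nat :=
  #|[set C in crossings | warping_crossing ov b C]|.

(* No warping degree exceeds [ncrossings], so taking it as the initial value
   of the two minima below changes no minimum over a nonempty family. *)
Definition diagram_warping_degree (ov O : {set D}) : nat :=
  \big[minn/ncrossings]_(b in O) warping_degree_at ov b.

Definition warping_degree : nat :=
  \big[minn/ncrossings]_(O in orientations)
    \big[minn/ncrossings]_(ov | crossing_info ov && alternating ov O)
      diagram_warping_degree ov O.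

End KnotProjection.

(* Main.v *)
Require Import Defs.
From mathcomp Require Import all_boot all_order all_algebra all_fingroup.
From mathcomp Require Import zify.

(* In an alternating diagram every edge runs from an over- to an under-passage,
   and the edges around a region do so coherently.  If all crossings of a region
   were warping (or all non-warping), then, as long as the base point is on none
   of its edges, the times of the passages met around the region would be
   strictly monotone, which is absurd on a cycle; so an independent set of
   regions away from the base crossing yields as many warping and as many
   non-warping crossings.  Moving the base point through a passage changes the
   warping degree by one, up after an over-passage and down after an
   under-passage: the degree is [d] or [d + 1], the larger value being
   attained just after an over-passage of the base crossing.
   That alternating diagrams exist is the checkerboard coloring: by Euler's
   formula, over F_2 the boundaries of the regions span all cycles, hence the
   sum of all the edges, every crossing being of even degree. *)

Set Implicit Arguments.
Unset Strict Implicit.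
Unset Printing Implicit Defensive.

(** * Orbits of permutations *)

Lemma porbit_perm1 (T : finType) (s : {perm T}) x : porbit s (s x) = porbit s x.
Proof. by have := porbit_perm s 1 x; rewrite expg1. Qed.

Lemma mem_porbit_perm (T : finType) (s : {perm T}) x y :
  (s y \in porbit s x) = (y \in porbit s x).
Proof. by rewrite -!eq_porbit_mem porbit_perm1. Qed.

Lemma porbit_invariant (T : finType) (S : Type) (s : {perm T}) (g : T -> S)
    x y :
  (forall z, g (s z) = g z) -> y \in porbit s x -> g y = g x.
Proof.
move=> g_s /porbitP[k ->]; elim: k => [|k IHk]; first by rewrite expg0 perm1.
by rewrite expgSr permM g_s.
Qed.

Lemma porbit_involution (T : finType) (s : {perm T}) x :
  involutive s -> porbit s x = [set x; s x].
Proof.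
move=> sK; apply/setP=> y; rewrite !inE; apply/porbitP/orP.
  case=> i ->; elim: i => [|i IHi]; first by rewrite expg0 perm1 eqxx; left.
  rewrite expgSr permM; case: IHi => /eqP ->; rewrite ?sK eqxx; first by right.
  by left.
case=> /eqP ->; first by exists 0%N; rewrite expg0 perm1.
by exists 1%N; rewrite expg1.
Qed.

(** * Counting incidences with orbits *)

Section Incidence.

Import GRing.Theory.
Local Open Scope ring_scope.

Variables (T : finType) (s : {perm T}).

Lemma porbit_in_porbits x : porbit s x \in porbits s.
Proof. exact: imset_f. Qed.

Definition porbit_idx (x : T) : 'I_#|porbits s| :=
  enum_rank_in (porbit_in_porbits x) (porbit s x).

Lemma enum_val_porbit_idx x : enum_val (porbit_idx x) = porbit s x.
Proof. by rewrite enum_rankK_in ?porbit_in_porbits. Qed.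

Lemma mem_enum_val_porbits (i : 'I_#|porbits s|) x :
  (x \in enum_val i) = (i == porbit_idx x).
Proof.
rewrite -(inj_eq enum_val_inj) enum_val_porbit_idx.
have /imsetP[y _ ->] := enum_valP i.
by rewrite eq_porbit_mem porbit_sym.
Qed.

Lemma porbit_idx_perm x : porbit_idx (s x) = porbit_idx x.
Proof. by apply: enum_val_inj; rewrite !enum_val_porbit_idx porbit_perm1. Qed.

Lemma porbit_idx_surj i : exists x, i = porbit_idx x.
Proof.
have /imsetP[x _ ix] := enum_valP i.
by exists x; apply: enum_val_inj; rewrite enum_val_porbit_idx.
Qed.

(** Double counting: each element of [A] lies in exactly one orbit. *)
Lemma sum_porbit_card (K : nzRingType) (v : 'I_#|porbits s| -> K)
    (A : {set T}) :
  \sum_i v i * #|enum_val i :&: A|%:R = \sum_(x in A) v (porbit_idx x).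
Proof.
under eq_bigr => i _.
  rewrite -sum1_card natr_sum mulr_sumr.
  under eq_bigl => x do rewrite inE andbC.
  rewrite big_mkcondr; over.
rewrite exchange_big /=; apply: eq_bigr => x _.
rewrite (bigD1 (porbit_idx x)) //= mem_enum_val_porbits eqxx mulr1.
rewrite big1 ?addr0 // => i /negPf nix.
by rewrite mem_enum_val_porbits nix.
Qed.

End Incidence.

(** * Checkerboard coloring by linear algebra over ['F_2] *)

Section Checkerboard.

Import GRing.Theory.
Local Open Scope ring_scope.

Variables (T : finType) (f : {perm T}).
Hypotheses (fK : involutive f) (f_neq : forall x, f x != x).

Lemma sum_porbit_edge (s : {perm T}) (v : 'I_#|porbits s| -> 'F_2) x :
  \sum_i v i * #|enum_val i :&: porbit f x|%:R
    = v (porbit_idx s x) + v (porbit_idx s (f x)).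
Proof.
rewrite sum_porbit_card porbit_involution // big_setU1 ?big_set1 //.
by rewrite inE eq_sym f_neq.
Qed.

(** Counting modulo 2 gives the boundary matrices of the cell structure: an edge with both darts in
    one orbit of [s] contributes 0. *)
Definition incidence_mx (s : {perm T}) :
    'M['F_2]_(#|porbits s|, #|porbits f|) :=
  \matrix_(i, j) #|enum_val i :&: enum_val j|%:R.

Lemma F2_add_eq0 (a b : 'F_2) : (a + b == 0) = (a == b).
Proof. by rewrite addr_eq0 oppr_pchar2 // pchar_Fp. Qed.

(* A vector of the left kernel of the incidence matrix is a function of the
   darts that is invariant under both permutations. *)
Lemma rank_incidence_mx (s : {perm T}) :
    (forall g : T -> 'F_2, (forall x, g (s x) = g x) ->
       (forall x, g (f x) = g x) -> forall x y, g x = g y) ->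
  (#|porbits s| <= (\rank (incidence_mx s)).+1)%N.
Proof.
move=> s_conn; rewrite -addn1 -leq_subLR -mxrank_ker.
(* It remains to show that the kernel lies in the line of constant vectors. *)
apply: leq_trans (rank_leq_row (const_mx 1 : 'rV['F_2]_#|porbits s|)).
apply/mxrankS/row_subP => i; set v := row i _.
have /sub_kermxP/rowP v0 : (v <= kermx (incidence_mx s))%MS by apply: row_sub.
have v_flip x : v 0 (porbit_idx s (f x)) = v 0 (porbit_idx s x).
  apply/esym/eqP; rewrite -F2_add_eq0 -sum_porbit_edge -(enum_val_porbit_idx f).
  have := v0 (porbit_idx f x); rewrite [LHS]mxE [RHS]mxE => v0x.
  rewrite -[X in _ == X]v0x; apply/eqP/eq_bigr => k _.
  by rewrite [incidence_mx _ _ _]mxE.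
have vC := s_conn (fun x => v 0 (porbit_idx s x)) _ v_flip.
apply/sub_rVP; exists (v 0 i); apply/rowP=> k.
rewrite [RHS]mxE [const_mx 1 _ _]mxE mulr1.
have [x ->] := porbit_idx_surj i; have [y ->] := porbit_idx_surj k.
by apply: (vC _ y x) => z; rewrite porbit_idx_perm.
Qed.

Variable t : {perm T}.
Let face := (f * t^-1)%g.

(** The two sides of the edge of [x] are the regions of the corners [x] and [t^-1 x]. Around a
    crossing each corner is thus counted twice, which is 0 modulo 2. *)
Lemma incidence_mx_face_vertex :
  incidence_mx face *m (incidence_mx t)^T = 0.
Proof.
have face_f x : face (f x) = (t^-1)%g x by rewrite permM fK.
apply/matrixP=> i k; rewrite !mxE.
under eq_bigr => j _ do rewrite !mxE (setIC (enum_val k)).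
rewrite (sum_porbit_card (fun j => #|enum_val i :&: enum_val j|%:R)).
have [y ->] := porbit_idx_surj k; rewrite enum_val_porbit_idx.
pose F x : 'F_2 := (x \in enum_val i)%:R.
transitivity (\sum_(x in porbit t y) (F x + F ((t^-1)%g x))).
  apply: eq_bigr => x _; rewrite enum_val_porbit_idx porbit_involution //.
  have -> : F (t^-1 x)%g = F (f x).
    by rewrite /F -face_f !mem_enum_val_porbits porbit_idx_perm.
  rewrite -sum1_card natr_sum.
  under eq_bigl => z do rewrite inE andbC.
  rewrite big_mkcondr big_setU1 ?big_set1 ?inE 1?eq_sym ?f_neq //= /F.
  by do 2!case: (_ \in enum_val i).
rewrite big_split /= [X in _ + X](reindex_inj (@perm_inj _ t)) /=.
under [X in _ + X]eq_big => [x|x _] do [rewrite mem_porbit_perm|rewrite permK].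
by rewrite addrr_pchar2 ?pchar_Fp.
Qed.

Lemma checkerboard_coloring :
    (forall g : T -> 'F_2, (forall x, g (t x) = g x) ->
       (forall x, g (f x) = g x) -> forall x y, g x = g y) ->
    (forall x, ~~ odd #|porbit t x|) ->
    (#|porbits t| + #|porbits face| = #|porbits f| + 2)%N ->
  exists g : T -> bool, forall x, g (face x) = g x /\ g (f x) = ~~ g x.
Proof.
move=> conn t_even eulerE.
have face_conn (g : T -> 'F_2) :
    (forall x, g (face x) = g x) -> (forall x, g (f x) = g x) ->
    forall x y, g x = g y.
  move=> g_face g_f; apply: conn => // x.
  by rewrite -(g_f (t x)) -g_face permM fK permK.
have one_cycle : (const_mx 1 : 'rV_#|porbits f|) *m (incidence_mx t)^T = 0.
  apply/rowP=> k; rewrite mxE.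
  under eq_bigr => j _ do rewrite mxE mxE mxE setIC.
  rewrite (sum_porbit_card (fun=> 1)) [RHS]mxE sumr_const.
  have [y ->] := porbit_idx_surj k; rewrite enum_val_porbit_idx.
  by apply/eqP; rewrite -(dvdn_pcharf (pchar_Fp (isT : prime 2))) dvdn2.
have face_ker : (incidence_mx face <= kermx (incidence_mx t)^T)%MS.
  by apply/sub_kermxP/incidence_mx_face_vertex.
(* With [V], [F], [E] the numbers of vertices, faces and edges, the kernel has dimension at most
   [E - (V - 1) = F - 1] by Euler's formula, and the face matrix has rank at least [F - 1]. *)
have rank_eq : \rank (incidence_mx face) = \rank (kermx (incidence_mx t)^T).
  apply/eqP; rewrite eqn_leq mxrankS //= mxrank_ker mxrank_tr.
  have := rank_incidence_mx conn; have := rank_incidence_mx face_conn.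
  rewrite leq_subLR.
  move: (\rank _) (\rank _) eulerE => r1 r2.
  by move: #|porbits t| #|porbits face| #|porbits f| => V F E; lia.
have /submxP[u oneE] :
    ((const_mx 1 : 'rV_#|porbits f|) <= incidence_mx face)%MS.
  have /mxrank_leqif_eq[_ /esym] := face_ker; rewrite rank_eq eqxx => /andP[_].
  by apply: submx_trans; apply/sub_kermxP.
(* The coefficients [u] express the sum of all edges through region boundaries; those on the two
   sides of an edge add up to 1, hence differ. *)
exists (fun x => u 0 (porbit_idx face x) == 1) => x.
rewrite porbit_idx_perm; split=> //.
have := congr1 (fun v : 'rV_#|porbits f| => v 0 (porbit_idx f x)) oneE.
rewrite mxE mxE; under eq_bigr => j _ do rewrite mxE enum_val_porbit_idx.
rewrite sum_porbit_edge.
by move: (u _ _) (u _ _) => [[|[|a]] ?] [[|[|b]] ?].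
Qed.
End Checkerboard.

(** * First matches in a sequence and minima of families *)

Lemma head_filterP (T : eqType) (p : pred T) (s : seq T) (d w : T) :
    w \in s -> p w ->
  let z := head d [seq y <- s | p y] in
  [/\ z \in s, p z & index z s <= index w s].
Proof.
elim: s => //= y s IHs; rewrite inE; case: ifP => [py _ _ | py].
  by rewrite inE /= eqxx py.
case/orP=> [/eqP -> | ws pw]; first by rewrite py.
have [zs pz zw] := IHs ws pw; rewrite inE zs orbT; split=> //.
have neq u : p u -> (y == u) = false by apply: contraTF => /eqP <-; rewrite py.
by rewrite !neq.
Qed.

Lemma bigminn_le (I : finType) (p : pred I) (f : I -> nat) (n : nat) (i : I) :
  p i -> \big[minn/n]_(j | p j) f j <= f i.
Proof.
rewrite -big_filter => pi; have: i \in [seq j <- index_enum I | p j].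
  by rewrite mem_filter pi mem_index_enum.
elim: [seq _ <- _ | _] => // j s IHs; rewrite inE big_cons geq_min.
by case/orP=> [/eqP -> | /IHs ->]; rewrite ?leqnn ?orbT.
Qed.

(** * Orientations of the curve *)

Section KnotProjectionTheory.

Variable P : knot_projection.

Local Notation D := (dart P).
Local Notation F := (flip P).
Local Notation T := (turn P).
Local Notation A := (ahead P).
Local Notation face := (map_face F T).
Local Notation O := (porbit A).

Implicit Types x y b : D.

Lemma aheadE x : A x = T (T (F x)).
Proof. by rewrite /ahead /map_ahead !permM. Qed.

Lemma turn_face x : T (face x) = F x.
Proof. by rewrite /map_face permM permKV. Qed.

Lemma turn4 x : T (T (T (T x))) = x.
Proof. by have := iter_porbit T x; rewrite four_valent. Qed.

Lemma ahead_flip x : A (F x) = T (T x).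
Proof. by rewrite aheadE flipK. Qed.

Lemma porbit_turnE x : porbit T x =i [:: x; T x; T (T x); T (T (T x))].
Proof. by move=> y; rewrite porbit_traject four_valent. Qed.

Lemma turn_uniq x : uniq [:: x; T x; T (T x); T (T (T x))].
Proof. by have := uniq_traject_porbit T x; rewrite four_valent. Qed.

Lemma turn_neq x : T x != x.
Proof. by have := turn_uniq x; rewrite /= !inE eq_sym; case: eqP. Qed.

Lemma turn2_neq x : T (T x) != x.
Proof.
have := turn_uniq x; rewrite /= !inE.
by case: eqP => // _; rewrite eq_sym; case: eqP.
Qed.

Lemma ahead_expSr k x : (A ^+ k.+1)%g x = A ((A ^+ k)%g x).
Proof. by rewrite expgSr permM. Qed.

(* Reversing the direction of travel is a symmetry of the curve. *)
Lemma ahead_exp_flip k x : (A ^+ k)%g (F ((A ^+ k)%g x)) = F x.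
Proof.
elim: k x => [|k IHk] x; first by rewrite expg0 !perm1.
have expl y : (A ^+ k.+1)%g y = (A ^+ k)%g (A y) by rewrite expgS permM.
by rewrite expl ahead_expSr ahead_flip aheadE turn4 IHk.
Qed.

(* [F] and [T^2] act on the orbit as reflections of a cycle; were [F x] on the
   orbit of [x], one of the two would fix the point halfway. *)
Lemma flip_notin_orientation x : F x \notin O x.
Proof.
apply/porbitP=> -[k Fx].
have expA m n y : (A ^+ m)%g ((A ^+ n)%g y) = (A ^+ (n + m))%g y.
  by rewrite expgD permM.
have [z [Fz | Az]] : exists z, F z = z \/ F (A z) = z.
  have := odd_double_half k; rewrite -addnn; move: k./2 => m kE.
  exists ((A ^+ m)%g x); case: (odd k) kE => kE; [right | left].
    apply: (@perm_inj _ (A ^+ m.+1)%g).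
    rewrite -ahead_expSr.
    by rewrite ahead_exp_flip Fx expA -kE addnS.
  by apply: (@perm_inj _ (A ^+ m)%g); rewrite ahead_exp_flip Fx expA -kE.
- by have := flip_neq z; rewrite Fz eqxx.
- by have := turn2_neq (F z); rewrite -aheadE -[A z]flipK Az eqxx.
Qed.

Lemma orientation_ahead b x : (A x \in O b) = (x \in O b).
Proof. exact: mem_porbit_perm. Qed.

(** At least one dart of each edge is on the orbit by [one_circle], at most one by
    [flip_notin_orientation]. *)
Lemma orientation_flip b x : (F x \in O b) = (x \notin O b).
Proof.
case xb: (x \in O b); last by have := one_circle b x; rewrite xb.
have := flip_notin_orientation x.
by rewrite (eqP (_ : O x == O b)) ?eq_porbit_mem // => /negPf.
Qed.

Lemma orientation_turn2 b x : (T (T x) \in O b) = (x \notin O b).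
Proof. by rewrite -ahead_flip orientation_ahead orientation_flip. Qed.

(** * Times of passages from a base point *)

Section Itinerary.

Variable b : D.

Lemma mem_itinerary : itinerary b =i O b.
Proof.
by move=> x; rewrite /itinerary -(porbit_perm1 A b) -porbit_traject.
Qed.

Lemma itinerary_uniq : uniq (itinerary b).
Proof. by rewrite /itinerary -(porbit_perm1 A b) uniq_traject_porbit. Qed.

(** The dart [b] comes last in the itinerary; there the index would wrap around to 0. *)
Lemma index_itinerary_ahead x : x \in O b -> x != b ->
  index (A x) (itinerary b) = (index x (itinerary b)).+1.
Proof.
move=> xO xb; have xs : x \in itinerary b by rewrite mem_itinerary.
have nthE i : i < #|O b| -> nth (A b) (itinerary b) i = iter i A (A b).
  by move=> lt_i; rewrite /itinerary nth_traject.
have := nth_index (A b) xs; have := xs; rewrite -index_mem size_traject.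
set i := index _ _ => lt_i; rewrite nthE // => xE.
have lt_i1 : i.+1 < #|O b|.
  rewrite ltn_neqAle lt_i andbT; apply: contra xb => /eqP iE.
  by rewrite -xE -iterSr iE iter_porbit.
have -> : A x = nth (A b) (itinerary b) i.+1.
  by rewrite nthE // iterS xE.
by rewrite index_uniq ?itinerary_uniq // size_traject.
Qed.

(* The passage of the curve through a crossing along the strand of [x]. *)
Definition passage x := if x \in O b then x else T (T x).

(** Opposite darts have the same time, so a crossing has two times, [time x] and [time (T x)]. *)
Definition time x := index (passage x) (itinerary b).

Lemma passage_in x : passage x \in O b.
Proof.
by rewrite /passage; case: ifP => // /negbT; rewrite orientation_turn2.
Qed.

Lemma passage_in_itinerary x : passage x \in itinerary b.
Proof. by rewrite mem_itinerary passage_in. Qed.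

Lemma time_inj x y : time x = time y -> y = x \/ y = T (T x).
Proof.
move/(index_inj x (passage_in_itinerary x) (passage_in_itinerary y)).
rewrite /passage.
case: ifP => _; case: ifP => _ E.
- by left.
- by right; rewrite E turn4.
- by right.
- by left; apply/esym/(@perm_inj _ T)/(@perm_inj _ T).
Qed.

Lemma time_turn_neq x : time (T x) != time x.
Proof.
apply/eqP=> /time_inj[] xE.
  by have := turn_neq x; rewrite -xE eqxx.
by have := turn2_neq (T x); rewrite -xE => /eqP; rewrite xE turn4; apply.
Qed.

Lemma time_flip x : x != b -> F x != b ->
  time (F x) = (time x).+1 \/ time x = (time (F x)).+1.
Proof.
have oriented y : y \in O b -> y != b -> time (F y) = (time y).+1.
  move=> yO yb; rewrite /time /passage orientation_flip yO /= -aheadE.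
  exact: index_itinerary_ahead.
move=> xb fxb; case xO: (x \in O b); [left | right]; first exact: oriented.
by rewrite -{1}[x]flipK oriented // orientation_flip xO.
Qed.

(** * Times around a region away from the base crossing *)

Section Region.

Variable x0 : D.
Hypothesis P_reduced : reduced P.
Hypothesis far_b : ~~ incident (porbit face x0) (porbit T b).

Lemma region_avoids_base x : x \in porbit face x0 -> x != b /\ F x != b.
Proof.
have far y : y \in porbit face x0 -> b \notin porbit T y.
  move=> yR; apply: contra far_b => bC.
  by apply/set0Pn; exists y; rewrite inE yR porbit_sym.
move=> xR; split; apply/eqP=> E.
  by have := far x xR; rewrite -E porbit_id.
have := far (face x); rewrite /= mem_porbit_perm => /(_ xR).
by rewrite -E -turn_face mem_porbit_perm porbit_id.
Qed.

Lemma reduced_turn2 x : T (T x) \notin porbit face x.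
Proof.
apply/negP=> xR; move/forall_inP: P_reduced => /(_ (porbit T x)).
rewrite imset_f // => /(_ isT)/negP; apply.
apply/exists_inP; exists (porbit face x); first exact: imset_f.
by apply/exists_inP; exists x; rewrite ?porbit_id.
Qed.

(** Equal times mean that [face x] is the corner opposite to [x], or that the region has the single
    corner [x]. In the latter case the neighboring corners [T x] and [T (T (T x))] share a region.
    Reducedness excludes both. *)
Lemma time_face_neq x : time (face x) != time x.
Proof.
apply/eqP=> /esym/time_inj[] faceE; last first.
  by have := reduced_turn2 x; rewrite -faceE mem_porbit_perm porbit_id.
have faceT : face (T x) = T (T (T x)).
  apply: (@perm_inj _ T); rewrite turn_face turn4 -{1}faceE turn_face.
  exact: flipK.
by have := reduced_turn2 (T x); rewrite -faceT mem_porbit_perm porbit_id.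
Qed.

(** Otherwise a corner [x] of maximal time satisfies [time (face x) > time (F x) >= time x - 1], so
    [time (face x) = time x], against [time_face_neq]. *)
Lemma region_turn_later : exists2 x, x \in porbit face x0 & time x < time (T x).
Proof.
apply/exists_inP; apply: contraT; rewrite negb_exists_in => /forall_inP late.
case: (arg_maxnP time (porbit_id face x0)) => x xR x_max.
have fxR : face x \in porbit face x0 by rewrite mem_porbit_perm.
have /= := x_max _ fxR; have := late _ fxR; rewrite turn_face.
have [xb fxb] := region_avoids_base xR.
have := time_face_neq x; have := time_turn_neq (face x); rewrite turn_face.
by case: (time_flip xb fxb); lia.
Qed.

(** The mirror argument, at a corner of minimal time. *)
Lemma region_turn_earlier :
  exists2 x, x \in porbit face x0 & time (T x) < time x.
Proof.
apply/exists_inP; apply: contraT; rewrite negb_exists_in => /forall_inP early.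
case: (arg_minnP time (porbit_id face x0)) => x xR x_min.
have fxR : face x \in porbit face x0 by rewrite mem_porbit_perm.
have /= := x_min _ fxR; have := early _ fxR; rewrite turn_face.
have [xb fxb] := region_avoids_base xR.
have := time_face_neq x; have := time_turn_neq (face x); rewrite turn_face.
by case: (time_flip xb fxb); lia.
Qed.

End Region.

(** * Warping crossings in terms of times *)

Lemma first_passage_turn x :
  first_passage b (porbit T x)
    = if time (T x) < time x then passage (T x) else passage x.
Proof.
have passageC y : y \in porbit T x -> passage y \in porbit T x.
  by move=> yC; rewrite /passage; case: ifP; rewrite ?mem_porbit_perm.
have TxC : T x \in porbit T x by rewrite mem_porbit_perm porbit_id.
have := passageC _ TxC; have := passageC _ (porbit_id T x).
rewrite /first_passage => pC pTC.
have [zs zC z_min] := head_filterP b (passage_in_itinerary x) pC.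
have [_ _ zT_min] := head_filterP b (passage_in_itinerary (T x)) pTC.
move: (head b _) zs zC z_min zT_min => z; rewrite mem_itinerary => zO zC.
have [-> | ->] : z = passage x \/ z = passage (T x).
  have {zC} : z \in porbit T x by []; rewrite porbit_turnE !inE /passage.
  by case/or4P=> /eqP E; move: zO; rewrite {}E ?orientation_turn2;
    do ?[move=> -> | move=> /negPf ->]; [left | right | left | right].
- by rewrite -!/(time _); case: ltnP => //; lia.
- rewrite -!/(time _) => + _; case: ltnP => // le1 le2.
  by have := time_turn_neq x; lia.
Qed.

Lemma warping_crossing_turn ov x : crossing_info ov ->
  warping_crossing ov b (porbit T x)
    = if x \in ov then time (T x) < time x else time x < time (T x).
Proof.
move=> /forallP ov_turn; rewrite /warping_crossing first_passage_turn.
have turn_ov y : (T y \in ov) = (y \notin ov) by apply/eqP.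
have passage_ov y : (passage y \in ov) = (y \in ov).
  by rewrite /passage; case: ifP; rewrite ?turn_ov ?negbK.
rewrite (fun_if (fun z => z \notin ov)) !passage_ov turn_ov negbK.
by have := time_turn_neq x; case: ltngtP; case: (x \in ov).
Qed.

End Itinerary.

(** * Moving the base point along the curve *)

Lemma crossingP C : reflect (exists x, C = porbit T x) (C \in crossings P).
Proof.
by apply: (iffP imsetP) => [[x _ ->] | [x ->]]; exists x.
Qed.

Lemma itinerary_step b :
  exists s, itinerary b = A b :: s /\ itinerary (A b) = rcons s (A b).
Proof.
rewrite /itinerary porbit_perm1.
have := iter_porbit A (A b); have := card_porbit_neq0 A b.
rewrite porbit_perm1; case: #|_| => // n _ iterA.
exists (traject A (A (A b)) n); split=> //.
by rewrite trajectSr -iterSr iterA.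
Qed.

Lemma time_step b x : passage b x != A b -> time b x = (time (A b) x).+1.
Proof.
have [s [sE s'E]] := itinerary_step b.
have pE : passage (A b) x = passage b x by rewrite /passage porbit_perm1.
have := passage_in_itinerary b x; rewrite /time pE sE s'E => ps neq.
move: ps; rewrite inE (negPf neq) /= eq_sym (negPf neq) => ps.
by rewrite -cats1 index_cat ps.
Qed.

Lemma time_ahead b : time b (A b) = 0.
Proof.
have [s [sE _]] := itinerary_step b.
by rewrite /time /passage orientation_ahead porbit_id sE /= eqxx.
Qed.

Lemma time_base b x : time b x <= time b b.
Proof.
have := passage_in_itinerary b x; rewrite -index_mem => time_lt.
rewrite -ltnS; apply: leq_trans time_lt _.
rewrite /time /passage porbit_id size_traject /itinerary.
have := iter_porbit A b; have := uniq_traject_porbit A (A b).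
rewrite porbit_perm1.
have := card_porbit_neq0 A b; case: #|_| => // n _ s_uniq iterA.
have -> : index b (traject A (A b) n.+1) = n; last by [].
rewrite -[X in index X _]iterA iterSr -(nth_traject _ (ltnSn n)).
by rewrite index_uniq // size_traject.
Qed.

(** Only the crossing of the passage [A b] changes status, as this passage goes from first to last.
    By alternation exactly one of [b] and [A b] is over, so the degree minus [(b \in ov)] is
    preserved. *)
Lemma warping_degree_at_step ov b : crossing_info ov -> alternating ov (O b) ->
  warping_degree_at ov (A b) + (b \in ov)
    = warping_degree_at ov b + (A b \in ov).
Proof.
move=> ov_info ov_alt.
have ov_b : (b \in ov) = (A b \notin ov).
  have /forall_inP/(_ b (porbit_id _ _)) := ov_alt.
  by case: (b \in ov); case: (A b \in ov).
have degE c : warping_degree_at ov c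
    = \sum_(C in crossings P) warping_crossing ov c C.
  rewrite /warping_degree_at -sum1_card big_mkcond [RHS]big_mkcond /=.
  by apply: eq_bigr => C _; rewrite inE; case: (C \in _).
have AC : porbit T (A b) \in crossings P by exact: imset_f.
rewrite !degE (bigD1 _ AC) [X in _ = X + _](bigD1 _ AC) /=.
(* At every other crossing both times drop by one, which keeps their order. *)
rewrite (eq_bigr (fun C => nat_of_bool (warping_crossing ov b C))); last first.
  move=> _ /andP[/crossingP[x ->] xA]; congr nat_of_bool.
  rewrite !warping_crossing_turn //.
  have pA y : y \in porbit T x -> passage b y != A b.
    move=> yx; apply: contra xA => /eqP E; rewrite eq_porbit_mem porbit_sym.
    by rewrite -E /passage; case: ifP; rewrite ?mem_porbit_perm.
  by rewrite !(time_step (pA _ _)) ?mem_porbit_perm ?porbit_id.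
rewrite !warping_crossing_turn // time_ahead ltn0.
have := time_base (A b) (T (A b)); have := time_turn_neq (A b) (A b).
have := time_turn_neq b (A b); rewrite time_ahead.
by rewrite ov_b; case: (A b \in ov) => /=; lia.
Qed.

Lemma warping_degree_at_orientation ov b b' :
    crossing_info ov -> alternating ov (O b) -> b' \in O b ->
  warping_degree_at ov b' + (b \in ov) = warping_degree_at ov b + (b' \in ov).
Proof.
move=> ov_info ov_alt /porbitP[k ->]; elim: k => [|k IHk].
  by rewrite expg0 perm1.
rewrite ahead_expSr; set c := (A ^+ k)%g b in IHk *.
have := @warping_degree_at_step ov c ov_info.
have -> : O c = O b by rewrite porbit_perm.
by move=> /(_ ov_alt); lia.
Qed.

(** * Independent regions and warping crossings *)

Lemma card_independent (S W : {set {set D}}) :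
    independent S -> W \subset crossings P ->
    (forall R, R \in S -> exists2 C, C \in W & incident R C) ->
  #|S| <= #|W|.
Proof.
move=> /forall_inP S_ind /subsetP W_cross S_W.
pose f R := odflt set0 [pick C in W | incident R C].
have fP R : R \in S -> f R \in W /\ incident R (f R).
  move=> /S_W[C CW RC]; rewrite /f; case: pickP => [C' /andP[] // | /(_ C)].
  by rewrite CW RC.
(* Two distinct regions with the same chosen crossing would share it. *)
have f_inj : {in S &, injective f}.
  move=> R1 R2 R1S R2S fE; apply/eqP/contraT => neq.
  have /forall_inP/(_ _ R2S)/implyP/(_ neq)/forall_inP := S_ind _ R1S.
  have [fW1 R1f] := fP _ R1S; have [_] := fP _ R2S.
  by rewrite -fE => R2f /(_ _ (W_cross _ fW1)); rewrite R1f R2f.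
rewrite -(card_in_imset f_inj); apply/subset_leq_card/subsetP.
by move=> _ /imsetP[R RS ->]; have [] := fP R RS.
Qed.

(** The darts [A y] and [F y] lie on the same strand, so alternation along the orientation is a
    condition on the two ends of each edge. *)
Lemma ov_flip ov b x : crossing_info ov -> alternating ov (O b) ->
  (F x \in ov) = (x \notin ov).
Proof.
move=> /forallP ov_turn /forall_inP ov_alt.
have turn_ov y : (T y \in ov) = (y \notin ov) by apply/eqP.
have oriented y : y \in O b -> (F y \in ov) = (y \notin ov).
  move=> /ov_alt; rewrite aheadE !turn_ov negbK.
  by case: (_ \in ov); case: (_ \in ov).
case xO: (x \in O b); first exact: oriented.
by rewrite -{2}[x]flipK (oriented (F x)) ?negbK // orientation_flip xO.
Qed.

Lemma independent_regions_bound ov b S :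
    reduced P -> crossing_info ov -> alternating ov (O b) ->
    independent_region_set (porbit T b) S ->
  #|S| <= warping_degree_at ov b /\
  #|S| + warping_degree_at ov b <= ncrossings P.
Proof.
move=> P_red ov_info ov_alt /and3P[/subsetP S_reg S_ind /forall_inP S_far].
pose W := [set C in crossings P | warping_crossing ov b C].
have corners R : R \in S ->
    (exists2 C, C \in W & incident R C) /\
    (exists2 C, C \in crossings P :\: W & incident R C).
  move=> RS; have /imsetP[x0 _ RE] := S_reg R RS.
  have := S_far R RS; rewrite {}RE => far.
  (* Coherence around the region: [F x] is [T (face x)], so going from [x] to [face x] switches over
     and under twice. *)
  have ov_face x : x \in porbit face x0 -> (x \in ov) = (x0 \in ov).
    apply: (porbit_invariant (g := fun y => y \in ov)) => y.
    have /forallP/(_ (face y))/eqP := ov_info.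
    by rewrite turn_face (ov_flip _ ov_info ov_alt) => /negb_inj.
  have inc x : x \in porbit face x0 -> incident (porbit face x0) (porbit T x).
    by move=> xR; apply/set0Pn; exists x; rewrite inE xR porbit_id.
  have [x xR xlt] := region_turn_later P_red far.
  have [y yR ylt] := region_turn_earlier P_red far.
  have Tcross z : porbit T z \in crossings P by apply/crossingP; exists z.
  (* If the corner darts are over, the warping crossing is that of [y] and the non-warping one that
     of [x]; if they are under, the roles are exchanged. *)
  by case x0ov: (x0 \in ov); split;
    [exists (porbit T y) | exists (porbit T x)
    | exists (porbit T x) | exists (porbit T y)];
    rewrite ?inc // !inE Tcross warping_crossing_turn // ov_face // x0ov //=;
    rewrite -leqNgt ltnW.
have WC : W \subset crossings P by apply/subsetP=> C; rewrite inE => /andP[].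
split; first by apply: card_independent => // R /corners[].
have := cardsID W (crossings P); rewrite (setIidPr WC) /ncrossings => <-.
rewrite addnC leq_add2l; apply: card_independent => //; first exact: subsetDl.
by move=> R /corners[].
Qed.

(** * Existence of alternating diagrams *)

Lemma alternating_exists :
  exists ov : {set D}, crossing_info ov /\ forall o : {set D}, alternating ov o.
Proof.
have conn (g : D -> 'F_2) : (forall x, g (T x) = g x) ->
    (forall x, g (F x) = g x) -> forall x y, g x = g y.
  move=> g_T g_F x y; have g_A z : g (A z) = g z by rewrite aheadE !g_T g_F.
  by have /orP[] := one_circle x y => /(porbit_invariant g_A); rewrite ?g_F.
have T_even x : ~~ odd #|porbit T x| by rewrite four_valent.
have [g gP] :=
  checkerboard_coloring (@flipK P) (@flip_neq P) conn T_even (euler P).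
have g_F x : g (F x) = ~~ g x by have [] := gP x.
have g_T x : g (T x) = ~~ g x.
  have [+ _] := gP (F (T x)); rewrite permM flipK permK g_F => ->.
  by rewrite negbK.
(* A dart is over when the region of its corner is colored. Consecutive corners at a crossing are
   separated by an edge, so their colors differ. *)
exists [set x | g x]; split; first by apply/forallP=> x; rewrite !inE g_T.
move=> o; apply/forall_inP=> x _; rewrite !inE aheadE !g_T negbK g_F.
by case: (g x).
Qed.

Lemma card_dart_gt0 : 0 < #|D|.
Proof.
rewrite lt0n; apply/negP=> /eqP D0.
have porbits0 (s : {perm D}) : #|porbits s| = 0.
  apply: eq_card0 => C; apply/imsetP=> -[x _ _].
  by have := fintype0 x D0.
by have := euler P; rewrite !porbits0.
Qed.

(** * The two bounds on the warping degree *)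

Lemma warping_degree_le ov b : crossing_info ov -> alternating ov (O b) ->
  warping_degree P <= warping_degree_at ov b.
Proof.
move=> ov_info ov_alt; rewrite /warping_degree.
have Ob : O b \in orientations P by exact: imset_f.
apply: leq_trans (@bigminn_le _ (fun o => o \in _) _ _ _ Ob) _.
apply: leq_trans (@bigminn_le _ _ _ _ ov _) _; first by rewrite ov_info.
exact: (@bigminn_le _ (fun c => c \in O b) _ _ _ (porbit_id _ _)).
Qed.

(** The hypothesis [m <= ncrossings P] takes care of the initial value of the nested minima. *)
Lemma warping_degree_ge m :
    m <= ncrossings P ->
    (forall ov b, crossing_info ov -> alternating ov (O b) ->
      m <= warping_degree_at ov b) ->
  m <= warping_degree P.
Proof.
move=> mN m_le; rewrite /warping_degree.
apply: (big_ind (leq m)) => // [k l mk ml | _ /imsetP[x _ ->]].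
  by rewrite leq_min mk.
apply: (big_ind (leq m)) => // [k l mk ml | ov /andP[ov_info ov_alt]].
  by rewrite leq_min mk.
apply: (big_ind (leq m)) => // [k l mk ml | b bO]; first by rewrite leq_min mk.
by apply: m_le => //; rewrite (eqP (_ : O b == O x)) ?eq_porbit_mem.
Qed.

Lemma crossing_over_dart ov C : crossing_info ov -> C \in crossings P ->
  exists2 x, C = porbit T x & x \in ov.
Proof.
move=> /forallP ov_turn /crossingP[x ->]; case xov: (x \in ov).
  by exists x.
exists (T x); first by rewrite porbit_perm1.
by rewrite (eqP (ov_turn x)) xov.
Qed.

Lemma IR_le m :
    (forall b S, independent_region_set (porbit T b) S -> #|S| <= m) ->
  IR P <= m.
Proof.
move=> le_m; apply/bigmax_leqP=> _ /crossingP[x ->].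
by apply/bigmax_leqP=> S; apply: le_m.
Qed.

(* The extra one: from a base point just after the over-passage of the base
   crossing, moving on through the next passage lowers the warping degree. *)
Lemma IR_upper_bound :
  reduced P -> IR P + (warping_degree P).+1 <= ncrossings P.
Proof.
move=> P_red; have [ov [ov_info ov_alt]] := alternating_exists.
have bound b S : independent_region_set (porbit T b) S ->
    #|S| + (warping_degree P).+1 <= ncrossings P.
  have [x -> xov] : exists2 x, porbit T b = porbit T x & x \in ov.
    by apply: crossing_over_dart => //; apply/crossingP; exists b.
  move=> /(independent_regions_bound P_red ov_info (ov_alt _))[_].
  have := warping_degree_le ov_info (ov_alt (O (A x))).
  have := warping_degree_at_step ov_info (ov_alt (O x)).
  have /forall_inP/(_ x (porbit_id _ _)) := ov_alt (O x).
  by rewrite xov; case: (A x \in ov) => //; lia.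
have /card_gt0P[b _] := card_dart_gt0.
(* The empty region set gives this inequality, which makes the truncated subtraction below exact. *)
have degree_lt : (warping_degree P).+1 <= ncrossings P.
  have := bound b set0; rewrite cards0; apply.
  apply/and3P; split; first exact: sub0set.
    by apply/forall_inP=> R; rewrite inE.
  by apply/forall_inP=> R; rewrite inE.
rewrite addnC -leq_subRL //; apply: IR_le => c S /bound.
by rewrite addnC leq_subRL.
Qed.

(** Once a base crossing is fixed, the base point can be moved just after its under-passage, where
    the degree is the smaller of the two values and still bounds the number of independent
    regions. *)
Lemma IR_lower_bound : reduced P -> IR P <= warping_degree P.
Proof.
move=> P_red; apply: warping_degree_ge.
  by have := IR_upper_bound P_red; lia.
move=> ov b ov_info ov_alt; apply: IR_le => c S.
have [x -> xov] : exists2 x, porbit T c = porbit T x & x \in ov.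
  by apply: crossing_over_dart => //; apply/crossingP; exists c.
(* As [x] is over, the strand of [T x] is under; [passage] selects its dart on the orientation of
   [b]. *)
pose y := passage b (T x).
have yov : y \notin ov.
  have ovT z : (T z \in ov) = (z \notin ov) by apply/eqP/(forallP ov_info).
  by rewrite /y /passage; case: ifP; rewrite !ovT xov.
have <- : porbit T y = porbit T x.
  by rewrite /y /passage; case: ifP; rewrite !porbit_perm1.
have yO : y \in O b by exact: passage_in.
have Oy : O y = O b by apply/eqP; rewrite eq_porbit_mem.
have := warping_degree_at_orientation ov_info ov_alt yO.
rewrite (negPf yov) => degE S_ind.
have [] := independent_regions_bound P_red ov_info _ S_ind; first by rewrite Oy.
by lia.
Qed.

End KnotProjectionTheory.

Theorem theorem1p1 (P : knot_projection) :
  reduced P ->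
  (IR P <= warping_degree P)%N /\
  ((warping_degree P)%:Z <= (ncrossings P)%:Z - (IR P)%:Z - 1)%R.
Proof.
move=> P_red; split; first exact: IR_lower_bound.
by have := IR_upper_bound P_red; lia.
Qed.
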